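(* Let $q$ be a prime power, $h\geq1$ an integer, $F=\mathbb{F}_{q^m}$, and let $U\leq F^k$ be an extremal $h$-scattered $q$-system, where $k\geq h+1$. (1) If $m=h+1$, then $U$ is equivalent to $\mathbb{F}_q^k$. (2) If $m=h+2$, write $k=a(m-1)+r$ with $a\geq1$ and $0\leq r<m-1$, and put $$\mathcal G_m=\{(x,x^q,\ldots,x^{q^{m-2}}):x\in F\}\leq F^{m-1}.$$ Then $U$ is equivalent to $$\mathcal G_m^{\oplus a}\oplus\mathbb{F}_q^r\leq F^k,$$ where the summands occupy disjoint $F$-coordinate blocks ($a$ blocks of length $m-1$ and one block of length $r$). In particular, the cases $m=h+1$ and $m=h+2$ yield no equivalence classes of extremal $h$-scattered $q$-systems in $F^k$ beyond these elementary direct sums.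
   Context: An $[n,k]_{q^m/q}$ $q$-system is an $n$-dimensional $\mathbb{F}_q$-subspace $U\leq F^k$ with $\langle U\rangle_F=F^k$. It is $h$-scattered if $\dim_{\mathbb{F}_q}(U\cap H)\leq h$ for every $h$-dimensional $F$-subspace $H\leq F^k$. An $h$-scattered $[n,k]_{q^m/q}$ $q$-system is extremal if $n=\lfloor km/(h+1)\rfloor$. Two systems $U,U'$ in $F^k$ are equivalent if $U'=B(\sigma(U))$ for some $B\in\operatorname{GL}(k,F)$ and some $\sigma\in\operatorname{Aut}(F)$ (the full field automorphism group, acting coordinatewise). *)

(* Defs.v *)
From HB Require Import structures.
From mathcomp Require Import all_boot all_order all_algebra all_field.

Set Implicit Arguments.
Unset Strict Implicit.
Unset Printing Implicit Defensive.

Import GRing.Theory.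
Local Open Scope ring_scope.

(* Conventions. The base field F_q is a finite field Fq, so q = #|Fq|, and the
   field F_{q^m} is a field extension F of Fq of degree m = \dim {:F}.
   The set F^k occurs with two linear structures on the same carrier:
   {vspace F ^ k} is the type of Fq-subspaces, {vspace F^o ^ k} that of
   F-subspaces.  Vectors of the one are converted silently to the other. *)

Section Systems.
Variables (Fq : finFieldType) (F : fieldExtType Fq).
Implicit Types k n h l r : nat.

Definition Fspan k (U : {vspace F ^ k}) : {vspace F^o ^ k} :=
  <<(vbasis U : seq (F^o ^ k)%type)>>%VS.

(* An F-subspace regarded as an Fq-subspace: products of an Fq-basis of F with
   an F-basis of H form an Fq-basis of H; see mem_resFq. *)
Definition resFq k (H : {vspace F^o ^ k}) : {vspace F ^ k} :=
  <<[seq ((a : F) *: (b : (F^o ^ k)%type) : (F ^ k)%type)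
       | a <- vbasis {:F}, b <- vbasis H]>>%VS.

Definition qsystem n k (U : {vspace F ^ k}) : Prop :=
  \dim U = n /\ Fspan U = fullv.

Definition scattered h k (U : {vspace F ^ k}) : Prop :=
  forall H : {vspace F^o ^ k}, \dim H = h -> (\dim (U :&: resFq H) <= h)%N.

Definition extremal_scattered h k (U : {vspace F ^ k}) : Prop :=
  qsystem ((k * \dim {:F}) %/ h.+1) U /\ scattered h U.

(* v |-> B (sigma v), on column vectors. *)
Definition semilin k (B : 'M[F]_k) (sigma : F -> F) (v : F ^ k) : (F ^ k)%type :=
  [ffun i => \sum_j B i j * sigma (v j)].

(* sigma ranges over all field automorphisms, not only the Fq-linear ones. *)
Definition equivalent k (U U' : {vspace F ^ k}) : Prop :=
  exists (B : 'M[F]_k) (sigma : {rmorphism F -> F}),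
    [/\ B \in unitmx, bijective sigma &
        forall w, w \in U' <-> exists2 v, v \in U & w = semilin B sigma v].

Definition Fqpow_fun r (c : Fq^o ^ r) : (F ^ r)%type := [ffun i => (c i)%:A].

Definition Fqpow r : {vspace F ^ r} := limg (linfun (@Fqpow_fun r)).

Definition Gsys_fun l (x : F) : (F ^ l)%type := [ffun j : 'I_l => x ^+ (#|Fq| ^ j)].

(* The system written G_m is Gsys (m - 1). *)
Definition Gsys l : {vspace F ^ l} := limg (linfun (Gsys_fun l)).

Definition injl k1 k2 (u : F ^ k1) : (F ^ (k1 + k2))%type :=
  [ffun i => if split i is inl j then u j else 0].
Definition injr k1 k2 (u : F ^ k2) : (F ^ (k1 + k2))%type :=
  [ffun i => if split i is inr j then u j else 0].

Definition dsum k1 k2 (U : {vspace F ^ k1}) (V : {vspace F ^ k2}) :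
    {vspace F ^ (k1 + k2)} :=
  (linfun (@injl k1 k2) @: U + linfun (@injr k1 k2) @: V)%VS.

Fixpoint dpow l (U : {vspace F ^ l}) (a : nat) : {vspace F ^ (a * l)} :=
  if a is a'.+1 then dsum U (dpow U a') else 0%VS.

Definition castsys k k' (e : k = k') (U : {vspace F ^ k}) : {vspace F ^ k'} :=
  ecast i {vspace F ^ i} e U.

Definition elementary h k (E : {vspace F ^ k}) : Prop :=
  (\dim {:F} = h.+1 /\ E = Fqpow k) \/
  (\dim {:F} = h.+2 /\
   exists (a r : nat) (e : (a * (\dim {:F} - 1) + r)%N = k),
     [/\ (1 <= a)%N, (r < \dim {:F} - 1)%N &
         E = castsys e (dsum (dpow (Gsys (\dim {:F} - 1)) a) (Fqpow r))]).

Lemma mem_resFq k (H : {vspace F^o ^ k}) (v : F ^ k) :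
  (v \in resFq H) = ((v : (F^o ^ k)%type) \in H).
Proof.
apply/idP/idP => [|Hv].
  rewrite /resFq; set X := (X in <<X>>%VS).
  rewrite -[X]/(tval (in_tuple X)) => /coord_span ->.
  apply: (big_ind (fun x : (F ^ k)%type => (x : (F^o ^ k)%type) \in H)) => [|x y xH yH|i _].
  - exact: mem0v.
  - exact: (memvD xH yH).
  have : (in_tuple X)`_i \in X by rewrite mem_nth.
  case/allpairsP=> [[a b] /= [_ bH ->]]; set c := coord _ _ _.
  have -> : c *: ((a *: (b : (F^o ^ k)%type)) : (F ^ k)%type)
          = ((c%:A * a : F) *: (b : (F^o ^ k)%type)).
    by apply/ffunP => t; rewrite !ffunE mulr_algl [LHS]scalerAl.
  by apply: memvZ; apply: vbasis_mem.
have E : (v : (F^o ^ k)%type) = \sum_(i < \dim H) coord (vbasis H) i v *: (vbasis H)`_i.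
  exact: coord_vbasis.
have -> : v = \sum_(i < \dim H) \sum_(j < \dim {:F})
    coord (vbasis {:F}) j (coord (vbasis H) i v) *:
      (((vbasis {:F})`_j *: ((vbasis H)`_i : (F^o ^ k)%type)) : (F ^ k)%type).
  rewrite [LHS]E; apply: eq_bigr => i _.
  rewrite {1}(coord_vbasis (memvf (coord (vbasis H) i v : F))).
  apply/ffunP => t; rewrite !ffunE sum_ffunE -[LHS]/(_ * _) mulr_suml.
  by apply: eq_bigr => j _; rewrite !ffunE -scalerAl.
apply: memv_suml => i _; apply: memv_suml => j _.
apply: memvZ; apply: memv_span; apply/allpairsP.
by exists ((vbasis {:F})`_j, (vbasis H)`_i); split; rewrite //= mem_nth // size_tuple.
Qed.

Lemma Fspan_subP k (U : {vspace F ^ k}) (H : {vspace F^o ^ k}) :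
  (Fspan U <= H)%VS = (U <= resFq H)%VS.
Proof.
apply/idP/idP => [/span_subvP sH|/subvP sUH].
  rewrite -(span_basis (vbasisP U)); apply/span_subvP => u bu.
  by rewrite mem_resFq; apply: sH.
by apply/span_subvP => u bu; rewrite -mem_resFq; apply/sUH/vbasis_mem.
Qed.

Lemma mem_limg_linear (V W : vectType Fq) (f : V -> W) (U : {vspace V}) w :
  linear f -> (w \in (linfun f @: U)%VS) <-> (exists2 v, v \in U & w = f v).
Proof.
move=> lf.
pose fL : {linear V -> W} :=
  HB.pack f (GRing.isLinear.Build Fq V W _ f lf).
have fE : linfun f =1 f by move=> x; exact: (lfunE fL).
by split=> [/memv_imgP[v Uv ->]|[v Uv ->]]; [exists v|rewrite -fE memv_img].
Qed.

Lemma mem_Fqpow r (v : F ^ r) :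
  v \in Fqpow r <-> exists c : (Fq ^ r)%type, forall i, v i = (c i)%:A.
Proof.
have lf : linear (@Fqpow_fun r).
  by move=> a x y; apply/ffunP => i; rewrite !ffunE scalerDl scalerA.
rewrite /Fqpow; split=> [/(mem_limg_linear _ _ lf)[c _ ->]|[c vE]].
  by exists c => i; rewrite ffunE.
apply/(mem_limg_linear _ _ lf); exists c; first exact: memvf.
by apply/ffunP => i; rewrite ffunE.
Qed.

Lemma mem_Gsys l (v : F ^ l) :
  v \in Gsys l <-> exists x : F, forall j, v j = x ^+ (#|Fq| ^ j).
Proof.
have lf : linear (Gsys_fun l).
  move=> a x y; apply/ffunP => i; rewrite !ffunE.
  have [p p_pr pF] := finPcharP Fq.
  have pFL : p \in [pchar F] by rewrite pchar_lalg.
  have nq : [pchar F].-nat (#|Fq| ^ i)%N.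
    rewrite pnatX; apply/orP; left.
    by rewrite (card_pprimeChar pF) pnatX pnatE // pFL.
  have -> : (a *: x + y) ^+ (#|Fq| ^ i) = (a *: x) ^+ (#|Fq| ^ i) + y ^+ (#|Fq| ^ i).
    exact: exprDn_pchar.
  rewrite exprZn; congr (_ *: _ + _).
  elim: (nat_of_ord i) => [|n IH]; first by rewrite expr1.
  by rewrite expnS exprM expf_card.
rewrite /Gsys; split=> [/(mem_limg_linear _ _ lf)[x _ ->]|[x vE]].
  by exists x => j; rewrite ffunE.
apply/(mem_limg_linear _ _ lf); exists x; first exact: memvf.
by apply/ffunP => j; rewrite ffunE.
Qed.

Lemma mem_dsum k1 k2 (U : {vspace F ^ k1}) (V : {vspace F ^ k2}) v :
  v \in dsum U V <->
  (([ffun i => v (lshift k2 i)] : (F ^ k1)%type) \in U) /\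
  (([ffun i => v (rshift k1 i)] : (F ^ k2)%type) \in V).
Proof.
have ll : linear (@injl k1 k2).
  move=> a x y; apply/ffunP => i; rewrite !ffunE.
  by case: (split i) => j; rewrite ?ffunE // scaler0 addr0.
have lr : linear (@injr k1 k2).
  move=> a x y; apply/ffunP => i; rewrite !ffunE.
  by case: (split i) => j; rewrite ?ffunE // scaler0 addr0.
split=> [/memv_addP[_ /(mem_limg_linear _ _ ll)[u Uu ->]]
         [_ /(mem_limg_linear _ _ lr)[w Vw ->] ->]|[Uv Vv]].
  split.
    have -> : [ffun i => (injl k2 u + injr k1 w) (lshift k2 i)] = u; last exact: Uu.
    by apply/ffunP => i; rewrite !ffunE (unsplitK (inl _ i)) addr0.
  have -> : [ffun i => (injl k2 u + injr k1 w) (rshift k1 i)] = w; last exact: Vw.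
  by apply/ffunP => i; rewrite !ffunE (unsplitK (inr _ i)) add0r.
set u := finfun _ in Uv; set w := finfun _ in Vv.
apply/memv_addP; exists (injl k2 u).
  by apply/(mem_limg_linear _ _ ll); exists u.
exists (injr k1 w); first by apply/(mem_limg_linear _ _ lr); exists w.
apply/ffunP => i; rewrite !ffunE -{1}(splitK i).
by case: (split i) => j /=; rewrite ffunE ?addr0 ?add0r.
Qed.

End Systems.

(* Main.v *)
From HB Require Import structures.
Require Import Defs.
From mathcomp Require Import all_boot all_order all_algebra all_field.

(** Let M be an n x k matrix whose rows form an Fq-basis of U, and let K be the
    left kernel of M, the F-space of F-linear relations between these rows.
    Since U spans F^k, the pair of n and K determines U up to GL(k, F): two
    matrices of full column rank with comparable left kernels differ by an
    invertible right factor (factor_of_kernel_sub).  So it suffices to bring K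
    into a standard shape by changing the Fq-basis of U.

    If m = h + 1 then n = k, hence K = 0 and M is invertible.

    If m = h + 2 and k = a (m - 1) + r then n = a m + r and dim K = a.
    Scatteredness says that h + 1 vectors of U independent over Fq are
    independent over F (scattered_row_free).  Therefore the entries of a nonzero
    relation cannot lie in a proper Fq-subspace of F: a nonzero relation whose
    entries span a space of dimension s <= h + 1 becomes, in a basis of that
    space, a nontrivial F-relation between s vectors of U independent over Fq.
    In particular a nonzero c in K has an entry of nonzero trace
    (relation_trace_eq0), i.e. taking the trace of each entry is an injection
    of K, of Fq-dimension a m, into Fq^n.

    Take a basis y of F over Fq and an F-basis X of K.  The traces of the rows
    y_i X_j are then a m independent vectors of Fq^n; complete them to an
    invertible matrix P.  If b is the basis dual to y for the trace form, then
    X_j = \sum_i b_i Tr (y_i X_j), so with respect to the Fq-basis P M of U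
    the relations are (t_1 b, ..., t_a b, 0) with t_j in F.  This space depends
    only on b, a and r.  It remains to see that it kills the analogous matrix of
    G_m^a + Fq^r, and this holds because b annihilates all the columns
    y ^+ (q ^ t), 0 < t < m (dual_row_Gsys): b is the first row of the inverse
    of the Moore matrix of y. *)

Set Implicit Arguments.
Unset Strict Implicit.
Unset Printing Implicit Defensive.

Import GRing.Theory.
Local Open Scope ring_scope.

(** * Matrices over a field *)

Section Matrices.
Variable K : fieldType.

Lemma row_free_completion s t n (p : 'M[K]_(s, n)) :
  row_free p -> (s + t <= n)%N -> exists q : 'M[K]_(t, n), row_free (col_mx p q).
Proof.
move=> fp le_n; have rp : \rank p = s by apply/eqP.
have rC : \rank (p^C)%MS = (n - s)%N by rewrite mxrank_compl rp.
have le_t : (t <= \rank (p^C)%MS)%N.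
  by rewrite rC leq_subRL // (leq_trans (leq_addr _ _) le_n).
pose q : 'M[K]_(t, n) := pid_mx t *m row_base (p^C)%MS.
have rq : \rank q = t by rewrite mxrankMfree ?row_base_free // rank_pid_mx.
exists q; rewrite /row_free -addsmxE mxrank_disjoint_sum ?rp ?rq //.
apply/eqP; rewrite -submx0 -(capmx_compl p) capmxS //.
by rewrite (submx_trans (submxMl _ _)) // eq_row_base.
Qed.

Lemma row_free_usub s t n (p : 'M[K]_(s, n)) (q : 'M[K]_(t, n)) :
  row_free (col_mx p q) -> row_free p.
Proof.
move=> fpq; apply: inj_row_free => v v0.
have : row_mx v (0 : 'rV_t) *m col_mx p q = 0 by rewrite mul_row_col v0 mul0mx addr0.
rewrite -(mul0mx _ (col_mx p q)) => /(row_free_inj fpq)/eqP.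
by rewrite row_mx_eq0 => /andP[/eqP].
Qed.

(** A matrix of full column rank is determined up to an invertible right factor
    by its left kernel; one inclusion of kernels is enough, as both have
    dimension n - k. *)
Lemma factor_of_kernel_sub n k (M N : 'M[K]_(n, k)) :
  row_full M -> row_full N ->
  (forall c : 'rV_n, c *m M = 0 -> c *m N = 0) ->
  exists2 B : 'M_k, B \in unitmx & N = M *m B.
Proof.
move=> fM fN kMN; have [L LM] := row_fullP fM.
have NE : N = M *m (L *m N).
  apply/row_matrixP => i; apply/eqP; rewrite -subr_eq0 !rowE -mulmxBr.
  rewrite mulmxA -{1}[N]mul1mx -mulmxBl mulmxA.
  apply/eqP/kMN.
  by rewrite -mulmxA mulmxBl mul1mx -mulmxA LM mulmx1 subrr mulmx0.
exists (L *m N) => //; rewrite -row_full_unit /row_full.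
by apply/eqP/anti_leq; rewrite rank_leq_col -{1}(eqP fN) {1}NE mxrankM_maxr.
Qed.

(** The block diagonal matrix with a copies of A.  The recursion is on a,
    parallel to that of dpow, so that the sizes agree by computation. *)
Fixpoint bdiag s t (A : 'M[K]_(s, t)) a : 'M[K]_(a * s, a * t) :=
  if a is a'.+1 then block_mx A 0 0 (bdiag A a') else 0.

Lemma bdiag_mul s t u (A : 'M[K]_(s, t)) (B : 'M[K]_(t, u)) a :
  bdiag A a *m bdiag B a = bdiag (A *m B) a.
Proof.
elim: a => [|a IH]; first by rewrite /= mulmx0.
by rewrite /= mulmx_block IH !mulmx0 !mul0mx !addr0 add0r.
Qed.

Lemma bdiag1 s a : bdiag (1%:M : 'M[K]_s) a = 1%:M.
Proof.
elim: a => [|a IH]; first by apply/matrixP => -[].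
by rewrite /= IH -scalar_mx_block.
Qed.

Lemma mul_bdiagS_col s t n a (A : 'M[K]_(s, t)) (X : 'M_(t, n)) (Y : 'M_(a * t, n)) :
  bdiag A a.+1 *m col_mx X Y = col_mx (A *m X) (bdiag A a *m Y).
Proof. by rewrite /= (@mul_block_col _ s (a * s)) !mul0mx addr0 add0r. Qed.

Lemma mul_row_bdiagS s t n a (A : 'M[K]_(s, t)) (X : 'M_(n, s)) (Y : 'M_(n, a * s)) :
  row_mx X Y *m bdiag A a.+1 = row_mx (X *m A) (Y *m bdiag A a).
Proof. by rewrite /= (@mul_row_block _ n s (a * s)) !mulmx0 addr0 add0r. Qed.

End Matrices.

(** * Frobenius maps and the trace *)

Section Extension.
Variables (Fq : finFieldType) (F : fieldExtType Fq).
Local Notation q := #|Fq|.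
Local Notation emb := (map_mx (in_alg F)).

Lemma expf_card_ext (x : F) : x ^+ (q ^ \dim {:F}) = x.
Proof. by apply/eqP; rewrite -Fermat's_little_theorem memvf. Qed.

Definition frob t (x : F) : F := x ^+ (q ^ t).

Lemma frob_linear t : linear (frob t).
Proof.
move=> c x y; rewrite /frob.
have [p p_pr pF] := finPcharP Fq.
have pFL : p \in [pchar F] by rewrite pchar_lalg.
rewrite exprDn_pchar; last first.
  by rewrite pnatX; apply/orP; left; rewrite (card_pprimeChar pF) pnatX pnatE // pFL.
rewrite exprZn; congr (_ *: _ + _).
elim: t => [|t IH]; first by rewrite expr1.
by rewrite expnS exprM expf_card.
Qed.

HB.instance Definition _ t :=
  GRing.isLinear.Build Fq F F _ (frob t) (frob_linear t).

Lemma frobM t : {morph frob t : x y / x * y}.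
Proof. by move=> x y; rewrite /frob exprMn. Qed.

Lemma frobS t x : frob 1 (frob t x) = frob t.+1 x.
Proof. by rewrite /frob expn1 -exprM expnSr. Qed.

Definition trace (x : F) : F := \sum_(t < \dim {:F}) frob t x.

Lemma trace_linear : linear trace.
Proof.
move=> c x y; rewrite /trace scaler_sumr -big_split.
by apply: eq_bigr => t _; rewrite linearP.
Qed.

HB.instance Definition _ := GRing.isLinear.Build Fq F F _ trace trace_linear.

(** The Frobenius map permutes the terms of the trace cyclically, and its fixed
    points are the elements of Fq. *)
Lemma trace_in1 x : exists c : Fq, trace x == c%:A.
Proof.
suff : trace x \in 1%AS by case/vlineP => c ->; exists c.
rewrite Fermat's_little_theorem dimv1 -/(frob 1 (trace x)) /trace linear_sum /=.
under eq_bigr do rewrite frobS.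
case: (\dim {:F}) (expf_card_ext x) => [|m] xE; first by rewrite !big_ord0.
rewrite big_ord_recr big_ord_recl /= addrC /frob xE expn0 expr1 //.
Qed.

(** The trace with values in Fq itself, so that it can produce matrices over Fq. *)
Definition qtrace (x : F) : Fq := xchoose (trace_in1 x).

Lemma qtraceE x : (qtrace x)%:A = trace x.
Proof. by rewrite /qtrace -(eqP (xchooseP (trace_in1 x))). Qed.

(** Otherwise \sum_t l_t X^(q^t) would be a nonzero polynomial of degree less
    than #|F| that vanishes on F. *)
Lemma qpoly_vanish s (l : 'I_s -> F) : (s <= \dim {:F})%N ->
  (forall x, \sum_t l t * frob t x = 0) -> forall t, l t = 0.
Proof.
move=> le_s vl.
have q1 : (1 < q)%N by exact: finNzRing_gt1.
pose P := \sum_(t < s) l t *: 'X^(q ^ t) : {poly F}.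
have P0 : P = 0.
  apply: (@roots_geq_poly_eq0 _ _ (enum (finvect_type F))).
  - apply/allP => x _; rewrite /root /P horner_sum; apply/eqP.
    by rewrite -[RHS](vl x); apply: eq_bigr => t _; rewrite hornerZ hornerXn.
  - exact: enum_uniq.
  - have -> : size (enum (finvect_type F)) = (q ^ \dim {:F})%N.
      rewrite -cardE -(card_vspace (fullv : {vspace finvect_type F})).
      by apply: eq_card => x; rewrite memvf.
    apply: (leq_trans (size_sum _ _ _)); apply/bigmax_leqP => t _.
    rewrite (leq_trans (size_scale_leq _ _)) // size_polyXn ltn_exp2l //.
    exact: leq_trans le_s.
move=> t; have := congr1 (fun p : {poly F} => p`_(q ^ t)) P0.
rewrite coef0 coef_sum (bigD1 t) //= big1 ?addr0.
  by rewrite coefZ coefXn eqxx mulr1.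
move=> u ut; rewrite coefZ coefXn eqn_exp2l // eq_sym.
by move/negPf: ut => /=; rewrite -val_eqE => ->; rewrite mulr0.
Qed.

(** The reason for separating coefficients in Fq from entries in F: an
    Fq-linear map of F acts on the entries only. *)
Lemma map_mx_linear_emb (f : {linear F -> F}) s n p
    (d : 'M[Fq]_(s, n)) (X : 'M[F]_(n, p)) :
  map_mx f (emb d *m X) = emb d *m map_mx f X.
Proof.
apply/matrixP => i0 j; rewrite !mxE linear_sum; apply: eq_bigr => i _.
by rewrite !mxE !mulr_algl linearZ.
Qed.

Lemma emb_qtrace n p (X : 'M[F]_(n, p)) : emb (map_mx qtrace X) = map_mx trace X.
Proof. by apply/matrixP => i j; rewrite !mxE; apply: qtraceE. Qed.

(** * A basis of F and its trace dual *)

Definition qfree n k (M : 'M[F]_(n, k)) := forall d : 'rV[Fq]_n, emb d *m M = 0 -> d = 0.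

Section Dual.
Variable l : nat.
Hypothesis dimF : \dim {:F} = l.+1.

Lemma field_basis_column : exists2 y : 'cV[F]_l.+1,
  (forall x, exists d : 'rV[Fq]_l.+1, x%:M = emb d *m y) &
  qfree y.
Proof.
rewrite -dimF; exists (\col_i (vbasis {:F})`_i) => [x|d d0].
  exists (\row_i coord (vbasis {:F}) i x).
  apply/matrixP => i j; rewrite !ord1 !mxE {1}(coord_vbasis (memvf x)) eqxx mulr1n.
  by apply: eq_bigr => t _; rewrite !mxE mulr_algl.
have /freeP fb := basis_free (vbasisP {:F}).
apply/rowP => i; rewrite mxE; apply: fb.
move/matrixP: d0 => /(_ 0 0); rewrite !mxE => d0; rewrite -[RHS]d0.
by apply: eq_bigr => t _; rewrite !mxE mulr_algl.
Qed.

Variable y : 'cV[F]_l.+1.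
Hypothesis y_span : forall x, exists d : 'rV[Fq]_l.+1, x%:M = emb d *m y.
Hypothesis y_free : qfree y.

Definition moore s : 'M[F]_(l.+1, s) := \matrix_(i, t) frob t (y i 0).
Definition Gsys_mx : 'M[F]_(l.+1, l) := \matrix_(i, t) frob t.+1 (y i 0).

(** A relation between the columns is a q-polynomial that vanishes on y, hence
    on its Fq-span F. *)
Lemma moore_free s (v : 'cV[F]_s) : (s <= l.+1)%N -> moore s *m v = 0 -> v = 0.
Proof.
move=> le_s v0; apply/colP => t; rewrite mxE; move: t.
apply: qpoly_vanish => [|x]; first by rewrite dimF.
have [d dE] := y_span x.
have xE : x = \sum_i d 0 i *: y i 0.
  move/matrixP: dE => /(_ 0 0); rewrite !mxE eqxx mulr1n => ->.
  by apply: eq_bigr => i _; rewrite !mxE mulr_algl.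
rewrite xE; under eq_bigr do rewrite linear_sum mulr_sumr.
rewrite exchange_big big1 //= => i _.
under eq_bigr do rewrite linearZ /= -scalerAr.
rewrite -scaler_sumr.
move/colP: v0 => /(_ i); rewrite !mxE => v0.
rewrite -[X in _ *: X](_ : 0 = _) ?scaler0 // -[LHS]v0.
by apply: eq_bigr => t _; rewrite mxE mulrC.
Qed.

Lemma moore_unit : moore l.+1 \in unitmx.
Proof.
rewrite -unitmx_tr -row_free_unit; apply: inj_row_free => v v0.
apply: trmx_inj; rewrite trmx0; apply: moore_free => //.
by apply: trmx_inj; rewrite trmx_mul trmxK v0 trmx0.
Qed.

(** The trace-dual basis of y, read off from the Moore matrix: dual_rowE says
    that it is orthogonal to every Frobenius conjugate of y but y itself. *)
Definition dual_row : 'rV[F]_l.+1 := row 0 (invmx (moore l.+1)).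

Lemma dual_rowE (t : 'I_l.+1) : \sum_i dual_row 0 i * frob t (y i 0) = (t == 0)%:R.
Proof.
have /matrixP/(_ 0 t) := mulVmx moore_unit; rewrite !mxE eq_sym => <-.
by apply: eq_bigr => i _; rewrite !mxE.
Qed.

Lemma dual_row_Gsys : dual_row *m Gsys_mx = 0.
Proof.
apply/rowP => t; rewrite !mxE -[RHS](dual_rowE (lift 0 t)).
by apply: eq_bigr => i _; rewrite !mxE lift0.
Qed.

(** The columns of Gsys_mx are columns of the invertible Moore matrix. *)
Lemma Gsys_mx_full : row_full Gsys_mx.
Proof.
rewrite /row_full -mxrank_tr -/(row_free Gsys_mx^T).
apply: inj_row_free => v v0.
have mE : moore l.+1 *m (col_mx (0 : 'cV_1) v^T : 'cV_(1 + l)) = Gsys_mx *m v^T.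
  have -> : moore l.+1 = row_mx (moore 1) Gsys_mx :> 'M_(l.+1, 1 + l).
    apply/matrixP => i t; rewrite [in RHS]mxE mxE -[t in LHS](splitK t).
    by case: (split t) => u; rewrite /= !mxE //=.
  by rewrite (@mul_row_col _ _ 1) mulmx0 add0r.
have /eqP : (col_mx (0 : 'cV_1) v^T : 'cV_(1 + l)) = 0.
  apply: (@moore_free l.+1) => //.
  by rewrite mE; apply: trmx_inj; rewrite trmx_mul trmxK v0 trmx0.
by rewrite col_mx_eq0 => /andP[_ /eqP] /(congr1 trmx); rewrite trmxK trmx0.
Qed.

(** The expansion x = \sum_i b_i Tr (y_i x): exchange the sums and apply
    dual_rowE to each conjugate of x. *)
Lemma dual_row_trace n (X : 'rV[F]_n) : dual_row *m map_mx trace (y *m X) = X.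
Proof.
apply/rowP => j; rewrite mxE.
apply: (@etrans _ _
  (\sum_(t < l.+1) frob t (X 0 j) * \sum_i dual_row 0 i * frob t (y i 0))).
  under [RHS]eq_bigr do rewrite mulr_sumr.
  rewrite exchange_big /=; apply: eq_bigr => i _.
  rewrite !mxE big_ord1 /trace dimF mulr_sumr; apply: eq_bigr => t _.
  by rewrite frobM mulrA mulrC.
rewrite big_ord_recl dual_rowE eqxx mulr1 big1 ?addr0 => [|t _].
  by rewrite /frob expr1.
by rewrite dual_rowE mulr0.
Qed.

Lemma bdiag_dual_row_trace n a (X : 'M[F]_(a * 1, n)) :
  bdiag dual_row a *m map_mx trace (bdiag y a *m X) = X.
Proof.
elim: a X => [|a IH] X; first by apply/matrixP => -[].
rewrite -[X](@vsubmxK _ 1 (a * 1)) mul_bdiagS_col.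
by rewrite (@map_col_mx _ _ trace l.+1 (a * l.+1)) mul_bdiagS_col dual_row_trace IH.
Qed.

Lemma bdiag_qfree a : qfree (bdiag y a).
Proof.
move=> d; elim: a d => [|a IH] d; first by move=> _; apply/rowP => -[].
rewrite -[d](@hsubmxK _ 1 l.+1 (a * l.+1)) (@map_row_mx _ _ _ 1 l.+1 (a * l.+1)).
rewrite (@mul_row_bdiagS F l.+1 1 1 a) => /eqP.
rewrite (@row_mx_eq0 _ 1 1 (a * 1)) => /andP[/eqP/y_free -> /eqP/IH ->].
by rewrite row_mx0.
Qed.

End Dual.

(** * Generator matrices of q-systems *)

Definition qspan n k (M : 'M[F]_(n, k)) (U : {vspace F ^ k}) :=
  forall v : (F ^ k)%type, v \in U <-> exists d : 'rV[Fq]_n, \row_j v j = emb d *m M.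

Lemma qspan_basis n k (U : {vspace F ^ k}) :
  \dim U = n -> exists2 M : 'M[F]_(n, k), qspan M U & qfree M.
Proof.
move=> <-; exists (\matrix_(i, j) (vbasis U)`_i j).
  move=> v; split=> [Uv|[d dE]].
    exists (\row_i coord (vbasis U) i v).
    apply/rowP => j; rewrite !mxE {1}(coord_vbasis Uv) sum_ffunE.
    by apply: eq_bigr => t _; rewrite !mxE mulr_algl ffunE.
  suff -> : v = \sum_i d 0 i *: (vbasis U)`_i.
    by apply: memv_suml => i _; rewrite memvZ // vbasis_mem // mem_nth ?size_tuple.
  apply/ffunP => j; move/rowP: dE => /(_ j); rewrite !mxE sum_ffunE => ->.
  by apply: eq_bigr => t _; rewrite !mxE mulr_algl ffunE.
have /freeP fb := basis_free (vbasisP U).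
move=> d d0; apply/rowP => i; rewrite mxE; apply: fb.
apply/ffunP => j; move/rowP: d0 => /(_ j); rewrite !mxE sum_ffunE ffunE => d0.
by rewrite -[RHS]d0; apply: eq_bigr => t _; rewrite !mxE mulr_algl ffunE.
Qed.

Lemma Fspan_row_full n k (M : 'M[F]_(n, k)) U :
  qspan M U -> Fspan U = fullv -> row_full M.
Proof.
move=> sMU spanU; rewrite -sub1mx; apply/row_subP => i.
pose x : (F^o ^ k)%type := [ffun j => (1%:M : 'M[F]_k) i j].
have -> : row i 1%:M = \row_j x j by apply/rowP => j; rewrite !mxE ffunE mxE.
have : x \in Fspan U by rewrite spanU memvf.
move/coord_span => ->.
have -> (c : 'I_(\dim U) -> F) :
    \row_j ((\sum_t c t *: ((vbasis U)`_t : (F^o ^ k)%type)) : (F ^ k)%type) j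
     = \sum_t c t *: (\row_j (vbasis U)`_t j : 'rV[F]_k).
  apply/rowP => j; rewrite mxE sum_ffunE summxE.
  by apply: eq_bigr => t _; rewrite ffunE !mxE.
apply: summx_sub => t _; apply: scalemx_sub.
have : (vbasis U)`_t \in U by rewrite vbasis_mem // mem_nth ?size_tuple.
by case/sMU => d ->; apply: submxMl.
Qed.

Lemma vspace_between (K : fieldType) (V : vectType K) (S : {vspace V}) h :
  (\dim S <= h)%N -> (h <= \dim {:V})%N -> exists2 H, (S <= H)%VS & \dim H = h.
Proof.
move=> leS; elim: h leS => [|h IH] leS leh.
  by exists S => //; apply/eqP; rewrite -leqn0.
move: leS; rewrite leq_eqVlt => /orP[/eqP eS|ltS]; first by exists S.
have [H sSH dH] := IH ltS (ltnW leh).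
have [v _ nHv] : exists2 v, v \in fullv & v \notin H.
  by apply/subvPn; apply: contraL leh => /dimvS; rewrite dH -leqNgt.
exists (H + <[v]>)%VS; first exact: subv_trans (addvSl _ _).
rewrite dimv_disjoint_sum.
  rewrite dH dim_vline (_ : v != 0) ?addn1 //.
  by apply: contraNneq nHv => ->; apply: mem0v.
apply/eqP; rewrite -subv0; apply/subvP => w; rewrite memv_cap => /andP[Hw /vlineP[c wE]].
rewrite wE in Hw *; have [->|c0] := eqVneq c 0; first by rewrite scale0r mem0v.
by move: Hw; rewrite rpredZeq (negPf c0) (negPf nHv).
Qed.

(** Scatteredness bounds only the subspaces H of dimension exactly h, whence two
    reductions: the s vectors are first completed to h + 1 independent vectors
    of U, and if these span a space of F-dimension at most h, that space is
    enlarged to dimension h.  It then meets U in Fq-dimension at least h + 1. *)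
Lemma scattered_row_free h n k s (M : 'M[F]_(n, k)) U (p : 'M[Fq]_(s, n)) :
  scattered h U -> (h < k)%N -> (h < n)%N -> qspan M U -> qfree M ->
  row_free p -> (s <= h.+1)%N -> row_free (emb p *m M).
Proof.
move=> scU ltk ltn sMU fM fp les.
wlog es : s p fp les / s = h.+1.
  move=> IH; have es : (s + (h.+1 - s) = h.+1)%N by rewrite subnKC.
  have [q' fq] : exists q' : 'M_(h.+1 - s, n), row_free (col_mx p q').
    by apply: row_free_completion; rewrite // es.
  have := IH _ _ fq (eq_leq es) es.
  by rewrite map_col_mx mul_col_mx => /row_free_usub.
subst s; set N := emb p *m M; apply/idPn => nfN.
have rN : (\rank N <= h)%N.
  by rewrite -ltnS ltn_neqAle nfN rank_leq_row.
(* The same row as a vector over Fq and as a vector over F. *)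
pose vec (r : 'rV[F]_k) : (F ^ k)%type := [ffun j => r 0 j].
pose vecO (r : 'rV[F]_k) : (F^o ^ k)%type := [ffun j => r 0 j].
pose S : {vspace F^o ^ k} := <<[seq vecO (row i (row_base N)) | i : 'I_(\rank N)]>>%VS.
have dS : (\dim S <= h)%N.
  by apply: leq_trans rN; rewrite (leq_trans (dim_span _)) // size_map size_enum_ord.
have dF : \dim (fullv : {vspace F^o ^ k}) = k.
  by rewrite dimvf /dim /= card_ord muln1.
have [H sSH dH] : exists2 H, (S <= H)%VS & \dim H = h.
  by apply: vspace_between => //; rewrite dF ltnW.
pose g (d : 'rV[Fq]_h.+1) : (F ^ k)%type := vec (emb d *m N).
have lg : linear g.
  move=> c x y; apply/ffunP => j; rewrite !ffunE map_mxD map_mxZ mulmxDl -scalemxAl.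
  by rewrite !mxE mulr_algl.
pose gL : {linear 'rV[Fq]_h.+1 -> (F ^ k)%type} :=
  HB.pack g (GRing.isLinear.Build _ _ _ _ g lg).
have dg : \dim (limg (linfun gL)) = h.+1.
  rewrite limg_dim_eq ?dimvf /dim /= ?mul1n //.
  apply/eqP; rewrite capfv -subv0; apply/subvP => d; rewrite memv_ker memv0 => /eqP.
  rewrite -[linfun _ d]/((linfun gL) d) lfunE /= => d0.
  apply/eqP; apply: (row_free_inj fp); rewrite mul0mx; apply: fM.
  rewrite map_mxM -mulmxA -/N; apply/rowP => j.
  have gj : g d j = 0 by rewrite [g d]d0 [LHS]ffunE.
  by rewrite [RHS]mxE -gj ffunE.
have := scU H dH; apply/negP; rewrite -ltnNge -dg; apply: dimvS.
apply/subvP => _ /memv_imgP[d _ ->]; rewrite lfunE /= memv_cap; apply/andP; split.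
  apply/sMU; exists (d *m p); rewrite map_mxM -mulmxA.
  by apply/rowP => j; rewrite mxE ffunE.
rewrite mem_resFq; apply: (subvP sSH).
have /submxP[D DE] : (emb d *m N <= row_base N)%MS by rewrite eq_row_base submxMl.
have -> : g d = \sum_i (D 0 i : F) *: vecO (row i (row_base N)).
  apply/ffunP => j; rewrite /g DE ffunE [LHS]mxE sum_ffunE.
  by apply: eq_bigr => i _; rewrite !ffunE [row _ _ _ _]mxE.
apply: memv_suml => i _; apply: memvZ; apply: memv_span; apply/mapP; exists i => //.
by rewrite mem_enum.
Qed.

(** Let C be the matrix of coordinates over Fq of the entries of c.  The trace
    is a nonzero functional that kills these entries, so C has rank s at most
    h + 1.  Factoring C through its s independent rows turns c into a relation
    between s vectors of U independent over Fq, which is zero by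
    scattered_row_free. *)
Lemma relation_trace_eq0 h n k (M : 'M[F]_(n, k)) U (c : 'rV[F]_n) :
  \dim {:F} = h.+2 -> scattered h U -> (h < k)%N -> (h < n)%N -> qspan M U -> qfree M ->
  c *m M = 0 -> map_mx trace c = 0 -> c = 0.
Proof.
move=> dimF scU ltk ltn sMU fM cM tc.
have [y y_span y_free] := field_basis_column dimF.
pose C : 'M[Fq]_(h.+2, n) := map_mx qtrace (y *m c).
have cE : c = dual_row y *m emb C by rewrite emb_qtrace (dual_row_trace dimF y_span).
have rC : (\rank C <= h.+1)%N.
  rewrite -ltnS ltn_neqAle rank_leq_row andbT; apply/negP => fC.
  (* The coordinates of 1 turn the trace into a left annihilator of C. *)
  have [d dE] := y_span 1.
  have : d = 0.
    apply: (row_free_inj fC); rewrite mul0mx; apply: (@map_mx_inj _ _ (in_alg F)).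
    by rewrite map_mxM emb_qtrace -map_mx_linear_emb mulmxA -dE mul1mx tc map_mx0.
  move=> d0; move: dE; rewrite d0 map_mx0 mul0mx => /matrixP/(_ 0 0)/eqP.
  by rewrite !mxE oner_eq0.
have fp := scattered_row_free scU ltk ltn sMU fM (row_base_free C) rC.
rewrite cE -(mulmx_base C) map_mxM mulmxA in cM *.
move: cM; rewrite -mulmxA -[X in _ = X -> _](mul0mx _ (emb (row_base C) *m M)).
by move/(row_free_inj fp) ->; rewrite mul0mx.
Qed.

(** P is a change of Fq-basis inside U and B acts on the ambient space; vectors
    are rows here and columns in semilin, hence the transpose in the proof. *)
Lemma equivalent_of_factor n k (M N : 'M[F]_(n, k)) U E (P : 'M[Fq]_n) (B : 'M[F]_k) :
  qspan M U -> qspan N E -> P \in unitmx -> B \in unitmx ->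
  N = emb P *m M *m B -> equivalent U E.
Proof.
move=> sMU sNE uP uB NE; exists B^T, idfun; split; rewrite ?unitmx_tr //.
  by exists idfun.
have semE v : \row_j semilin B^T idfun v j = (\row_j v j) *m B.
  apply/rowP => j; rewrite !mxE ffunE; apply: eq_bigr => i _.
  by rewrite !mxE mulrC.
have row_inj (v w : (F ^ k)%type) : \row_j v j = \row_j w j -> v = w.
  by move/rowP => vw; apply/ffunP => j; have := vw j; rewrite !mxE.
move=> w; split=> [/sNE[d dE]|[v /sMU[d dE] ->]].
  have [v vE] : exists v : (F ^ k)%type, \row_j v j = emb (d *m P) *m M.
    exists [ffun j => (emb (d *m P) *m M) 0 j].
    by apply/rowP => j; rewrite mxE ffunE.
  exists v; first by apply/sMU; exists (d *m P).
  by apply: row_inj; rewrite semE dE vE NE map_mxM !mulmxA.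
apply/sNE; exists (d *m invmx P); rewrite semE dE NE map_mxM !mulmxA.
by rewrite -[_ *m emb P]mulmxA -map_mxM mulVmx // map_mx1 mulmx1.
Qed.

(** * Generator matrices of the elementary systems *)

Lemma qspan_dsum n1 k1 n2 k2 (M : 'M[F]_(n1, k1)) (N : 'M[F]_(n2, k2)) U V :
  qspan M U -> qspan N V -> qspan (block_mx M 0 0 N) (dsum U V).
Proof.
move=> sMU sNV v; apply: (iff_trans (mem_dsum U V v)).
have vE : \row_j v j = row_mx (\row_j v (lshift k2 j)) (\row_j v (rshift k1 j)).
  apply/rowP => j; rewrite !mxE; case: splitP => i ij; rewrite mxE.
    by congr (v _); apply/val_inj.
  by congr (v _); apply/val_inj.
have fE p (f : 'I_p -> F) : \row_j [ffun i => f i] j = \row_j f j.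
  by apply/rowP => j; rewrite !mxE ffunE.
split=> [[/sMU[d dE] /sNV[d' dE']]|[d dE]].
  exists (row_mx d d'); rewrite vE map_row_mx mul_row_block !mulmx0 addr0 add0r.
  by rewrite -dE -dE' !fE.
move: dE; rewrite vE -[d]hsubmxK map_row_mx mul_row_block !mulmx0 addr0 add0r.
move/eq_row_mx => [dl dr]; split.
  by apply/sMU; exists (lsubmx d); rewrite fE.
by apply/sNV; exists (rsubmx d); rewrite fE.
Qed.

Lemma qspan_dpow n l (M : 'M[F]_(n, l)) U a : qspan M U -> qspan (bdiag M a) (dpow U a).
Proof.
move=> sMU; elim: a => [|a IH]; last exact: qspan_dsum.
move=> v; split=> _; last by rewrite memv0; apply/eqP/ffunP => -[].
by exists 0; apply/rowP => -[].
Qed.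

Lemma qspan_Fqpow r : qspan 1%:M (Fqpow F r).
Proof.
move=> v; apply: (iff_trans (mem_Fqpow v)); split=> [[c cE]|[d dE]].
  by exists (\row_j c j); rewrite mulmx1; apply/rowP => j; rewrite !mxE cE.
exists [ffun j => d 0 j] => i; move/rowP: dE => /(_ i).
by rewrite mulmx1 !mxE ffunE.
Qed.

(** The rows of Gsys_mx start with y_i ^+ q and not with y_i, which is what makes
    them orthogonal to the trace dual of y.  They still generate G_m because the
    Frobenius map is onto. *)
Lemma qspan_Gsys l (y : 'cV[F]_l.+1) : \dim {:F} = l.+1 ->
  (forall x, exists d : 'rV[Fq]_l.+1, x%:M = emb d *m y) -> qspan (Gsys_mx y) (Gsys F l).
Proof.
move=> dimF y_span v; apply: (iff_trans (mem_Gsys v)).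
have mE d x : x%:M = emb d *m y -> forall t, (emb d *m Gsys_mx y) 0 t = frob t.+1 x.
  move/matrixP/(_ 0 0); rewrite !mxE eqxx mulr1n => -> t; rewrite linear_sum mxE.
  by apply: eq_bigr => i _; rewrite !mxE !mulr_algl linearZ.
split=> [[x xE]|[d dE]].
  have [d dE] := y_span (frob l x); exists d; apply/rowP => t.
  rewrite (mE _ _ dE) mxE xE /frob -!exprM -expnD addnS -addSn expnD exprM.
  by rewrite -dimF expf_card_ext.
exists (frob 1 ((emb d *m y) 0 0)) => t.
have := mE d ((emb d *m y) 0 0); rewrite -mx11_scalar => /(_ erefl t).
rewrite -dE mxE => ->.
by rewrite /frob -exprM expn1 -expnS.
Qed.

(** * Classification *)

(** The case m = h + 2 in sizes that avoid subtraction: l is m - 1, so the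
    dimension of U is the extremal value a m + r. *)
Lemma extremal_normal_form h l a r (U : {vspace F ^ (a * l + r)}) :
  \dim {:F} = l.+1 -> l = h.+1 -> (h < a * l + r)%N ->
  \dim U = (a * l.+1 + r)%N -> Fspan U = fullv -> scattered h U ->
  equivalent U (dsum (dpow (Gsys F l) a) (Fqpow F r)).
Proof.
move=> dimF hl ltk dU spU scU.
have [y y_span y_free] := field_basis_column dimF.
have [M sMU fM] := qspan_basis dU.
have fullM := Fspan_row_full sMU spU.
have ltn : (h < a * l.+1 + r)%N.
  by apply: leq_trans ltk _; rewrite leq_add2r leq_mul2l leqnSn orbT.
(* The number of blocks is dim K = n - k; it is written a * 1 because block
   diagonal matrices with a blocks of one row have that height. *)
have [X fX kX] : exists2 X : 'M[F]_(a * 1, a * l.+1 + r), row_free X & (X :=: kermx M)%MS.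
  have <- : \rank (kermx M) = (a * 1)%N.
    by rewrite mxrank_ker (eqP fullM) subnDr -mulnBr subSnn.
  by exists (row_base (kermx M)); [apply: row_base_free|apply: eq_row_base].
have XM0 : X *m M = 0 by apply/sub_kermxP; rewrite kX.
(* The a * l.+1 rows of Xt are the traces of the rows y_i X_j. *)
pose Xt := map_mx qtrace (bdiag y a *m X).
have fXt : row_free Xt.
  apply: inj_row_free => d d0; apply: (bdiag_qfree y_free).
  apply: (row_free_inj fX); rewrite mul0mx.
  apply: (relation_trace_eq0 _ scU ltk ltn sMU fM); first by rewrite dimF hl.
    by rewrite -mulmxA XM0 mulmx0.
  by rewrite -mulmxA map_mx_linear_emb -emb_qtrace -map_mxM d0 map_mx0.
have [Y fY] : exists Y : 'M_(r, a * l.+1 + r), row_free (col_mx Xt Y).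
  exact: row_free_completion.
set P := col_mx Xt Y in fY.
have uP : P \in unitmx by rewrite -row_free_unit.
(* In the basis P of Fq^n the relations X become a copies of the dual of y. *)
have XE : X = row_mx (bdiag (dual_row y) a) 0 *m emb P.
  rewrite map_col_mx mul_row_col mul0mx addr0 emb_qtrace.
  by rewrite (bdiag_dual_row_trace dimF y_span).
pose N := block_mx (bdiag (Gsys_mx y) a) 0 0 (1%:M : 'M_r).
have fullN : row_full N.
  have [L LE] := row_fullP (Gsys_mx_full dimF y_span).
  apply/row_fullP; exists (block_mx (bdiag L a) 0 0 1%:M).
  rewrite mulmx_block !mulmx0 !mul0mx !addr0 add0r mulmx1 bdiag_mul LE bdiag1.
  by rewrite -scalar_mx_block.
have fullPM : row_full (emb P *m M).
  have := map_unitmx (in_alg F) P; rewrite uP -row_full_unit => fP.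
  by rewrite /row_full (eqmxMfull _ fP).
have [|B uB NE] := factor_of_kernel_sub fullPM fullN.
  move=> c cPM.
  have /submxP[D DE] : (c *m emb P <= X)%MS.
    by rewrite kX; apply/sub_kermxP; rewrite -mulmxA.
  have -> : c = D *m row_mx (bdiag (dual_row y) a) 0.
    have fP : row_free (emb P) by rewrite row_free_map.
    by apply: (row_free_inj fP); rewrite DE XE mulmxA.
  rewrite -mulmxA mul_row_block !mulmx0 mul0mx !addr0 bdiag_mul.
  rewrite (dual_row_Gsys dimF y_span).
  have -> : bdiag (0 : 'M[F]_(1, l)) a = 0.
    by elim: (a) => //= ? ->; rewrite block_mx0.
  by rewrite row_mx0 mulmx0.
apply: (equivalent_of_factor sMU _ uP uB NE).
by apply: qspan_dsum; [apply/qspan_dpow/qspan_Gsys|apply: qspan_Fqpow].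
Qed.

Lemma extremal_standard k (U : {vspace F ^ k}) :
  \dim U = k -> Fspan U = fullv -> equivalent U (Fqpow F k).
Proof.
move=> dU spU; have [M sMU _] := qspan_basis dU.
have uM : M \in unitmx by rewrite -row_full_unit (Fspan_row_full sMU).
have ME : 1%:M = emb 1%:M *m M *m invmx M by rewrite map_mx1 mul1mx mulmxV.
apply: (equivalent_of_factor sMU (@qspan_Fqpow k) _ _ ME); first exact: unitmx1.
by rewrite unitmx_inv.
Qed.

End Extension.

Theorem proposition2p7 (Fq : finFieldType) (F : fieldExtType Fq)
    (m h k : nat) (U : {vspace F ^ k}) :
  \dim {:F} = m -> (1 <= h)%N -> (h + 1 <= k)%N ->
  extremal_scattered h U ->
  [/\ m = (h + 1)%N -> equivalent U (Fqpow F k),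
      m = (h + 2)%N -> forall (a r : nat) (e : (a * (m - 1) + r)%N = k),
        (1 <= a)%N -> (r < m - 1)%N ->
        equivalent U (castsys e (dsum (dpow (Gsys F (m - 1)) a) (Fqpow F r)))
    & m = (h + 1)%N \/ m = (h + 2)%N ->
      exists E : {vspace F ^ k}, elementary h E /\ equivalent U E].
Proof.
move=> dimF h1 hk [[dU spU] scU].
have case1 : m = (h + 1)%N -> equivalent U (Fqpow F k).
  move=> mE; apply: extremal_standard => //.
  by rewrite dU dimF mE addn1 mulnK.
have case2 : m = (h + 2)%N -> forall (a r : nat) (e : (a * (m - 1) + r)%N = k),
    (1 <= a)%N -> (r < m - 1)%N ->
    equivalent U (castsys e (dsum (dpow (Gsys F (m - 1)) a) (Fqpow F r))).
  move=> mE a r e; have mE1 : (m - 1 = h.+1)%N by rewrite mE addn2 subn1.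
  move: e; rewrite mE1 => e a1 r1; case: k / e U hk dU spU scU {case1} => U hk dU spU scU.
  have dU' : \dim U = (a * h.+2 + r)%N.
    rewrite dU dimF mE addn2 mulnS -addnA [(r + _)%N]addnC addnA -mulnDl divnMDl //.
    by rewrite divn_small // addn0 [in RHS]mulnS addnA.
  rewrite addn1 in hk; rewrite mE addn2 in dimF.
  exact: (extremal_normal_form dimF erefl hk dU' spU scU).
split=> // -[mE|mE].
  by exists (Fqpow F k); split; [left; rewrite dimF mE addn1|apply: case1].
have e : (k %/ (m - 1) * (m - 1) + k %% (m - 1))%N = k by rewrite -divn_eq.
have a1 : (1 <= k %/ (m - 1))%N by rewrite divn_gt0 mE addn2 subn1 // -addn1.
have r1 : (k %% (m - 1) < m - 1)%N by rewrite ltn_mod mE addn2 subn1.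
exists (castsys e (dsum (dpow (Gsys F (m - 1)) (k %/ (m - 1))) (Fqpow F (k %% (m - 1))))).
split; last exact: case2.
right; split; first by rewrite dimF mE addn2.
move: e a1 r1; rewrite -dimF => e a1 r1.
by exists (k %/ (\dim {:F} - 1))%N, (k %% (\dim {:F} - 1))%N, e.
Qed.
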